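(* Let $G$ be an antiferromagnetic weighted graph and let $\mathcal{K}$ be the class of all complete graphs. If $H$ is a $\mathcal{K}$-blow-up of a bipartite graph $F$, then \[ \hom(H,G)^2\le \hom(H\times K_2,G). \]
   Context: A weighted graph $G$ on a finite vertex set is given by a symmetric function $G:V(G)\times V(G)\to\mathbb{R}_{\ge 0}$ (equivalently a symmetric nonnegative matrix); loops (positive diagonal entries) are allowed. $G$ is antiferromagnetic if this symmetric matrix has at most one positive eigenvalue, counted with multiplicity. For a graph $H$, $\hom(H,G)=\sum_{\phi:V(H)\to V(G)}\prod_{uv\in E(H)}G(\phi(u),\phi(v))$. The tensor product $H\times K_2$ has vertex set $V(H)\times\{1,2\}$, with $(u,i)$ adjacent to $(v,j)$ iff $uv\in E(H)$ and $i\ne j$. For a class $\mathcal{H}$ of graphs and a graph $F$ on vertices $v_1,\dots,v_k$, an $\mathcal{H}$-blow-up of $F$ is obtained by choosing $H_1,\dots,H_k\in\mathcal{H}$, taking their disjoint union, and adding all edges between $V(H_i)$ and $V(H_j)$ whenever $v_iv_j\in E(F)$. *)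

(* Defs.v *)
From HB Require Import structures.
From mathcomp Require Import all_boot all_order all_algebra.
From mathcomp Require Import reals.
Set Implicit Arguments. Unset Strict Implicit. Unset Printing Implicit Defensive.
Import Order.TTheory GRing.Theory Num.Theory.
Local Open Scope ring_scope.

(* A weighted graph on vertex set 'I_m: a symmetric nonnegative real matrix
   (loops = positive diagonal entries allowed). *)
Definition weighted_graph (R : realType) (m : nat) (G : 'M[R]_m) : Prop :=
  G^T = G /\ (forall i j, 0 <= G i j).

(* At most one positive eigenvalue counted with multiplicity: every list of
   positive eigenvalues (with repetitions) whose product of linear factors
   divides the characteristic polynomial has length at most 1. *)
Definition antiferromagnetic (R : realType) (m : nat) (G : 'M[R]_m) : Prop :=
  forall s : seq R, all (fun x => 0 < x) s ->
    (\prod_(x <- s) ('X - x%:P)) %| char_poly G -> (size s <= 1)%N.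

Definition simple_graph (V : finType) (E : rel V) : Prop :=
  (forall u v, E u v = E v u) /\ (forall u, ~~ E u u).

Definition bipartite (V : finType) (E : rel V) : Prop :=
  exists c : V -> bool, forall u v, E u v -> c u != c v.

(* hom(H, G) for a simple graph H = (V, E): each unordered edge {u,v}
   counted once (u before v in the enumeration of V). *)
Definition homG (R : realType) (V : finType) (E : rel V) (m : nat)
    (G : 'M[R]_m) : R :=
  \sum_(phi : {ffun V -> 'I_m})
     \prod_(u : V) \prod_(v : V | E u v && (enum_rank u < enum_rank v)%N)
        G (phi u) (phi v).

Definition tensorK2 (V : finType) (E : rel V) : rel (V * bool) :=
  fun x y => E x.1 y.1 && (x.2 != y.2).

(* Blow-up of F (on 'I_k) by complete graphs K_{n i}: vertex i of F is
   replaced by a clique on 'I_(n i); cliques of adjacent vertices are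
   completely joined. *)
Definition blowup_vertex (k : nat) (n : 'I_k -> nat) : finType :=
  {i : 'I_k & 'I_(n i)}.

Definition blowup (k : nat) (F : rel 'I_k) (n : 'I_k -> nat)
    : rel (blowup_vertex n) :=
  fun x y => (x != y) && ((tag x == tag y) || F (tag x) (tag y)).
Arguments blowup {k} F n.
Arguments blowup_vertex {k} n.
Arguments homG {R V} E {m} G.
Arguments tensorK2 {V} E.

(* Main.v *)
(* Write hom(K_n; c) for the partition function of K_n with positive vertex
   weights c.  After swapping the two sheets of H x K_2 over one colour class
   of F, both sides of the inequality sum over pairs of maps V(H) -> V(G), the
   edges between distinct cliques are parallel in both, and only the edges
   inside the cliques differ: parallel for H + H, crossed for H x K_2.  Cross
   one clique at a time.  With everything outside the clique fixed, its
   vertices see weights c and d in the two copies, so it is enough to show that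
   hom(K_n; c) hom(K_n; d) <= hom(K_n x K_2; c, d).
   Conditioning on one vertex of each copy and induction on n reduce this to
   a_0 a_n <= a_1 a_(n-1), where a_j is the polarization of c |-> hom(K_n; c)
   at n - j copies of c and j copies of d.  This polynomial is Lorentzian: its
   partial derivatives have the same form with one vertex less and reweighted,
   the quadratic case is the assumption on G, and the Bochner argument of
   Shenfeld and van Handel passes from the derivatives to the polynomial, so
   a_j is log-concave.  That argument needs positive entries, which
   (1 + e J) G (1 + e J), J the all-ones matrix, provides for e > 0. *)
Require Import Defs.
From HB Require Import structures.
From mathcomp Require Import all_boot all_order all_algebra.
From mathcomp Require Import reals.
From mathcomp Require Import ring lra.
From mathcomp Require Import complex spectral.
Set Implicit Arguments.
Unset Strict Implicit.
Unset Printing Implicit Defensive.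
Import Order.TTheory GRing.Theory Num.Theory.
Local Open Scope ring_scope.

(** * Hyperbolic bilinear forms *)

Section Hyperbolic.
Variables (R : realFieldType) (m : nat).
Implicit Types (M : 'M[R]_m) (u v w h : 'rV[R]_m).

Definition bform M u v : R := (u *m M *m v^T) 0 0.

(** The reversed Cauchy-Schwarz inequality: for symmetric [M] it is equivalent to having at most one
    positive eigenvalue, but it is stated without a spectrum. *)
Definition hyperbolic M := forall u w,
  0 <= bform M w w -> bform M u u * bform M w w <= bform M u w ^+ 2.

Lemma bformE M u v :
  bform M u v = \sum_s \sum_t u 0 s * M s t * v 0 t.
Proof.
rewrite /bform mxE exchange_big; apply: eq_bigr => t _.
by rewrite !mxE mulr_suml; apply: eq_bigr.
Qed.

Lemma bformDl M u u' v : bform M (u + u') v = bform M u v + bform M u' v.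
Proof. by rewrite /bform !mulmxDl mxE. Qed.

Lemma bformZl M a u v : bform M (a *: u) v = a * bform M u v.
Proof. by rewrite /bform -!scalemxAl mxE. Qed.

Lemma bformC M u v : M^T = M -> bform M u v = bform M v u.
Proof.
move=> symM; rewrite !bformE exchange_big; apply: eq_bigr => t _.
by apply: eq_bigr => s _; rewrite -{1}symM mxE; ring.
Qed.

Lemma bform_sqr M a u v : M^T = M ->
  bform M (u + a *: v) (u + a *: v) =
  bform M u u + 2 * a * bform M u v + a ^+ 2 * bform M v v.
Proof.
move=> symM; rewrite bformDl bformZl ![bform M _ (u + _)]bformC //.
by rewrite !bformDl !bformZl [bform M v u]bformC //; ring.
Qed.

(** Subtracting a multiple of [w] moves [u] into the [M]-orthogonal complement of [h], where the
    form is at most 0. Multiplying by <w, M w> and completing the square gives the claim. *)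
Lemma hyperbolic_nsd M h : M^T = M ->
  (forall w, bform M w h = 0 -> bform M w w <= 0) -> hyperbolic M.
Proof.
move=> symM nsd u w w_ge0.
have [wh0|wh_neq0] := eqVneq (bform M w h) 0.
  by rewrite (@le_anti _ _ (bform M w w) 0) ?mulr0 ?sqr_ge0 ?w_ge0 ?nsd.
set c := - (bform M u h / bform M w h).
have x_le0 : bform M (u + c *: w) (u + c *: w) <= 0.
  by apply: nsd; rewrite bformDl bformZl mulNr divfK ?subrr.
rewrite bform_sqr // in x_le0.
have := ler_wpM2l w_ge0 x_le0; rewrite mulr0.
have := sqr_ge0 (c * bform M w w + bform M u w).
nra.
Qed.

Lemma psd_cauchy_schwarz M u v : M^T = M ->
  (forall w, 0 <= bform M w w) ->
  bform M u v ^+ 2 <= bform M u u * bform M v v.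
Proof.
move=> symM psd.
have [v0|v_neq0] := eqVneq (bform M v v) 0; last first.
  have v_gt0 : 0 < bform M v v by rewrite lt_def v_neq0 psd.
  have := psd (u + (- (bform M u v / bform M v v)) *: v).
  rewrite bform_sqr // => /(ler_wpM2r (psd v)); rewrite mul0r.
  set a := bform M u v; set b := bform M v v in v_neq0 *; set c := bform M u u.
  suff -> : (c + 2 * - (a / b) * a + (- (a / b)) ^+ 2 * b) * b = c * b - a ^+ 2.
    by rewrite subr_ge0.
  by field.
have [->|uv_neq0] := eqVneq (bform M u v) 0; first by rewrite expr0n v0 mulr0.
(* With <v, M v> = 0 the form is affine in the coefficient of [v]; this coefficient makes its value
   -1. *)
have := psd (u + (- ((bform M u u + 1) / (2 * bform M u v))) *: v).
rewrite bform_sqr // v0 mulr0 addr0.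
set a := bform M u v in uv_neq0 *; set c := bform M u u.
suff -> : c + 2 * - ((c + 1) / (2 * a)) * a = - 1 by rewrite lerNr oppr0 ler10.
by field.
Qed.

Lemma bform_diag (d : 'rV[R]_m) u v :
  bform (diag_mx d) u v = \sum_s d 0 s * u 0 s * v 0 s.
Proof.
rewrite bformE; apply: eq_bigr => s _; rewrite (bigD1 s) //= big1 => [|t neq].
  by rewrite mxE eqxx mulr1n addr0 [u 0 s * _]mulrC.
by rewrite mxE eq_sym (negPf neq) mulr0n mulr0 mul0r.
Qed.

Lemma bformB M M' u v : bform (M - M') u v = bform M u v - bform M' u v.
Proof. by rewrite /bform mulmxBr mulmxBl !mxE. Qed.

End Hyperbolic.

(** * The Bochner argument for an entrywise positive symmetric matrix *)

Section Bochner.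
Variables (R : realFieldType) (m : nat) (M : 'M[R]_m) (h : 'rV[R]_m).
Hypotheses (symM : M^T = M) (M_gt0 : forall s t, 0 < M s t).
Hypothesis (h_gt0 : forall s, 0 < h 0 s).

(** Chosen so that [h] lies in the kernel of [B = D - M]; in other words [h] is the Perron vector of
    [D^-1 M], with eigenvalue 1. *)
Definition perron_weight := \row_s ((h *m M) 0 s / h 0 s).
Local Notation d := perron_weight.
Local Notation D := (diag_mx d).
Local Notation B := (D - M).

Lemma perron_weight_gt0 s : 0 < d 0 s.
Proof.
rewrite mxE divr_gt0 // mxE (bigD1 s) //= ltr_wpDr ?mulr_gt0 //.
by apply: sumr_ge0 => t _; rewrite ltW ?mulr_gt0.
Qed.

Lemma perron_laplacian_sym : B^T = B.
Proof. by rewrite linearB /= tr_diag_mx symM. Qed.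

Lemma perron_laplacian_ker u : bform B u h = 0.
Proof.
rewrite bformC ?perron_laplacian_sym // /bform.
suff -> : h *m B = 0 by rewrite mul0mx mxE.
apply/rowP=> s; rewrite mulmxBr mul_mx_diag !mxE.
by rewrite mulrC divfK ?gt_eqF // subrr.
Qed.

(** Ground state substitution: in terms of u/h, [B] is the Laplacian of the network with
    conductances M_st h_s h_t. Hence [B] is positive semidefinite with kernel spanned by [h]. *)
Lemma perron_laplacianE u : 2 * bform B u u =
  \sum_s \sum_t M s t * h 0 s * h 0 t * (u 0 s / h 0 s - u 0 t / h 0 t) ^+ 2.
Proof.
pose A s t := M s t * h 0 t * u 0 s ^+ 2 / h 0 s.
have dE : bform D u u = \sum_s \sum_t A s t.
  rewrite bform_diag; apply: eq_bigr => s _.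
  rewrite !mxE !mulr_suml; apply: eq_bigr => t _.
  by rewrite /A -{1}symM mxE; field; rewrite gt_eqF.
rewrite bformB mulrBr mulrDl mul1r {2}dE exchange_big /= dE bformE.
rewrite -big_split mulr_sumr -sumrB; apply: eq_bigr => s _.
rewrite -big_split mulr_sumr -sumrB; apply: eq_bigr => t _.
have symst : M t s = M s t by rewrite -{1}symM mxE.
by rewrite /A symst /=; field; rewrite !gt_eqF.
Qed.

Lemma perron_laplacian_ge0 u : 0 <= bform B u u.
Proof.
rewrite -(pmulr_rge0 _ (@ltr0Sn R 1)) perron_laplacianE.
by apply: sumr_ge0 => s _; apply: sumr_ge0 => t _;
  rewrite mulr_ge0 ?sqr_ge0 // ltW ?mulr_gt0.
Qed.

Lemma perron_laplacian_eq0 u s t : bform B u u = 0 ->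
  u 0 s / h 0 s = u 0 t / h 0 t.
Proof.
move/(congr1 (fun x => 2 * x)); rewrite perron_laplacianE mulr0.
have ge0 i j : 0 <= M i j * h 0 i * h 0 j *
    (u 0 i / h 0 i - u 0 j / h 0 j) ^+ 2.
  by rewrite mulr_ge0 ?sqr_ge0 // ltW ?mulr_gt0.
move/psumr_eq0P => /(_ (fun i _ => sumr_ge0 _ (fun j _ => ge0 i j)) s isT).
move/psumr_eq0P => /(_ (fun j _ => ge0 s j) t isT) /eqP.
rewrite mulf_eq0 gt_eqF ?mulr_gt0 //= sqrf_eq0 subr_eq0.
by move/eqP.
Qed.

(** The range of [B] is the orthogonal complement of its kernel, where [w *m D] lies. Adding the
    square of u |-> <u, D h> makes the form definite, so that [B'] can be inverted. *)
Lemma perron_laplacian_solve w : bform D w h = 0 ->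
  exists u, u *m B = w *m D.
Proof.
move=> wh0; pose g := h *m D; pose B' := B + g^T *m g.
have ug u : u *m g^T = (bform D u h)%:M.
  by rewrite [LHS]mx11_scalar /g trmx_mul tr_diag_mx mulmxA.
have bB' u : bform B' u u = bform B u u + bform D u h ^+ 2.
  have -> : bform B' u u = bform B u u + bform (g^T *m g) u u.
    by rewrite /bform /B' (mulmxDr u B) mulmxDl [LHS]mxE.
  congr (_ + _); rewrite /bform mulmxA ug mul_scalar_mx -scalemxAl mxE expr2.
  by congr (_ * _); rewrite -[g]trmxK -trmx_mul ug tr_scalar_mx mxE eqxx mulr1n.
have B'_unit : B' \in unitmx.
  rewrite -row_free_unit -kermx_eq0; apply/rowV0P => u /sub_kermxP uB'0.
  have := bB' u; rewrite {1}/bform uB'0 mul0mx mxE => /esym/eqP.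
  rewrite paddr_eq0 ?perron_laplacian_ge0 ?sqr_ge0 // expf_eq0 /=.
  case/andP => /eqP/perron_laplacian_eq0 uh /eqP Duh.
  apply/rowP => s; rewrite mxE.
  have : bform D u h = (u 0 s / h 0 s) * bform D h h.
    rewrite !bform_diag mulr_sumr; apply: eq_bigr => t _.
    by rewrite (uh s t); field; rewrite gt_eqF.
  rewrite Duh => /esym/eqP; rewrite !mulf_eq0 invr_eq0 [h 0 s == 0]gt_eqF //.
  rewrite orbF => /orP[/eqP //|]; rewrite bform_diag gt_eqF //.
  rewrite (bigD1 s) //= ltr_wpDr ?mulr_gt0 ?perron_weight_gt0 //.
  by apply: sumr_ge0 => t _; rewrite ltW ?mulr_gt0 ?perron_weight_gt0.
exists (w *m D *m invmx B').
set u := _ *m invmx B'.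
have uB' : u *m B' = w *m D by rewrite /u mulmxKV.
have uB'E : u *m B' = u *m B + bform D u h *: g.
  by rewrite /B' (mulmxDr u B) mulmxA ug mul_scalar_mx.
(* Pairing the perturbed equation with [h] kills the [B] term and leaves <u, D h> <h, D h> = 0. *)
suff uh0 : bform D u h = 0 by rewrite -uB' uB'E uh0 scale0r addr0.
have := wh0; rewrite /bform -uB' uB'E mulmxDl mxE -[X in X + _]/(bform B u h).
rewrite perron_laplacian_ker add0r -scalemxAl mxE -[X in _ * X]/(bform D h h).
move/eqP; rewrite mulf_eq0 => /orP[/eqP //|/eqP].
rewrite -[X in _ -> X = 0]/(bform D u h) !bform_diag.
have h2_ge0 i : 0 <= d 0 i * h 0 i * h 0 i.
  by rewrite ltW // !mulr_gt0 ?perron_weight_gt0.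
move/psumr_eq0P => /(_ (fun i _ => h2_ge0 i)) h20.
apply: big1 => s _; have /eqP := h20 s isT.
by rewrite gt_eqF // !mulr_gt0 ?perron_weight_gt0.
Qed.

(* With B = D - M, solving B u = D w turns the hypothesis at u into
   <u, B u> <= <w, D w>, and Cauchy-Schwarz for the psd form B gives
   <w, D w>^2 = <u, B w>^2 <= <w, D w> <w, B w>, that is <w, M w> <= 0. *)
Lemma bochner_hyperbolic :
  (forall v, bform M v v <= \sum_s (v *m M) 0 s ^+ 2 / d 0 s) ->
  hyperbolic M.
Proof.
move=> bochner; apply: (hyperbolic_nsd symM (h := h)) => w Mwh0.
have symB := perron_laplacian_sym.
have Dwh0 : bform D w h = 0.
  by have := perron_laplacian_ker w; rewrite bformB Mwh0 subr0.
have [u uB] := perron_laplacian_solve Dwh0.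
have BuE x : bform B u x = bform D w x by rewrite /bform uB.
have symD : D^T = D by rewrite tr_diag_mx.
have uME : u *m M = (u + (-1) *: w) *m D.
  rewrite mulmxDl -scalemxAl scaleN1r -uB mulmxBr opprB addrCA.
  by rewrite subrr addr0.
have le1 := bochner u; rewrite uME in le1.
have {le1} : bform M u u <= bform D (u + (-1) *: w) (u + (-1) *: w).
  apply: (le_trans le1); rewrite bform_diag le_eqVlt; apply/orP; left.
  apply/eqP/eq_bigr => s _; rewrite mul_mx_diag mxE.
  by field; rewrite gt_eqF ?perron_weight_gt0.
rewrite bform_sqr // => le1.
have := BuE u; have := BuE w; rewrite ![bform B _ _]bformB => Buw Buu.
have := psd_cauchy_schwarz u w symB perron_laplacian_ge0.
rewrite !BuE => cs.
have symDuw : bform D w u = bform D u w by rewrite bformC.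
have le2 : bform D w u <= bform D w w by lra.
have Bww := perron_laplacian_ge0 w.
have {cs} le3 := le_trans cs (ler_wpM2r Bww le2).
rewrite bformB in le3 Bww.
have Dww : 0 <= bform D w w.
  rewrite bform_diag; apply: sumr_ge0 => s _.
  by rewrite -mulrA -expr2 mulr_ge0 ?sqr_ge0 // ltW // perron_weight_gt0.
have [D0|Dn0] := eqVneq (bform D w w) 0; first by lra.
have {Dn0}Dww : 0 < bform D w w by rewrite lt_def Dn0.
by move: le3; rewrite expr2 ler_pM2l //; lra.
Qed.

End Bochner.

(** By symmetry of the tensor, T_r(v, h) = (v M)_r. Hyperbolicity of each slice at v, h bounds
    T_r(v, v) by (v M)_r^2 / (h M)_r, and summing with weights h_r gives the hypothesis of the
    Bochner lemma. *)
Lemma local_hyperbolic (R : realFieldType) (m : nat) (T : 'I_m -> 'M[R]_m)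
    (h : 'rV[R]_m) :
  (forall r s t, 0 < T r s t) -> (forall r s t, T r s t = T s r t) ->
  (forall r s t, T r s t = T r t s) -> (forall s, 0 < h 0 s) ->
  (forall r, hyperbolic (T r)) -> hyperbolic (\sum_r h 0 r *: T r).
Proof.
move=> T_gt0 T12 T23 h_gt0 hypT; set M := \sum_r _.
have ME s t : M s t = \sum_r h 0 r * T r s t.
  by rewrite /M summxE; apply: eq_bigr => r _; rewrite mxE.
have symM : M^T = M.
  by apply/matrixP=> s t; rewrite mxE !ME; apply: eq_bigr => r _; rewrite T23.
have M_gt0 s t : 0 < M s t.
  rewrite ME (bigD1 s) //= ltr_wpDr ?mulr_gt0 //.
  by apply: sumr_ge0 => r _; rewrite ltW ?mulr_gt0.
have TvhE r v : bform (T r) v h = (v *m M) 0 r.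
  rewrite bformE mxE; apply: eq_bigr => s _; rewrite ME mulr_sumr.
  apply: eq_bigr => t _; rewrite [T t s r]T12 [T s t r]T23 [T s r t]T12.
  by ring.
have hM_gt0 r : 0 < (h *m M) 0 r.
  rewrite mxE (bigD1 r) //= ltr_wpDr ?mulr_gt0 //.
  by apply: sumr_ge0 => t _; rewrite ltW ?mulr_gt0.
apply: (@bochner_hyperbolic _ _ M h) => // v.
have -> : bform M v v = \sum_r h 0 r * bform (T r) v v.
  transitivity (\sum_r \sum_s \sum_t h 0 r * (v 0 s * T r s t * v 0 t)).
    rewrite bformE [RHS]exchange_big /=; apply: eq_bigr => s _.
    rewrite [RHS]exchange_big /=; apply: eq_bigr => t _.
    by rewrite ME mulr_sumr mulr_suml; apply: eq_bigr => r _; ring.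
  apply: eq_bigr => r _; rewrite bformE mulr_sumr; apply: eq_bigr => s _.
  by rewrite mulr_sumr.
apply: ler_sum => r _; rewrite [perron_weight _ _ _ _]mxE invf_div mulrA.
rewrite ler_pdivlMr //.
have := hypT r v h; rewrite !TvhE => /(_ (ltW (hM_gt0 r))).
move/(ler_wpM2l (ltW (h_gt0 r))); rewrite mulrA [X in _ <= X]mulrC.
by [].
Qed.

(** * Spectral theorem *)

Lemma char_poly_conjmx (K : fieldType) n (P D : 'M[K]_n) :
  P \in unitmx -> char_poly (invmx P *m D *m P) = char_poly D.
Proof.
move=> Punit; rewrite /char_poly.
have -> : char_poly_mx (invmx P *m D *m P) =
    map_mx polyC (invmx P) *m char_poly_mx D *m map_mx polyC P.
  rewrite /char_poly_mx mulmxBr mulmxBl !map_mxM; congr (_ - _).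
  rewrite -mulmxA -scalar_mxC mulmxA -map_mxM mulVmx // map_mx1 mul1mx //.
rewrite !det_mulmx mulrAC -det_mulmx -map_mxM mulVmx // map_mx1 det1 mul1r //.
Qed.

Section SpectralHyperbolic.
Local Open Scope sesquilinear_scope.
Variables (R : realType) (m : nat) (G : 'M[R]_m).
Hypothesis symG : G^T = G.
Local Notation C := (R[i]).
Local Notation toC := (real_complex R).
Let A : 'M[C]_m := map_mx toC G.
Let P := spectralmx A.
Let sp := spectral_diag A.

Lemma complexify_hermsymmx : A \is hermsymmx.
Proof.
apply: realsym_hermsym.
  by apply/is_hermitianmxP; rewrite expr0 scale1r map_mx_id // map_trmx symG.
by apply/mxOverP=> i j; rewrite mxE complex_real.
Qed.

Lemma complexify_spectralE : A = invmx P *m diag_mx sp *m P.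
Proof.
exact/orthomx_spectralP/hermitian_normalmx/complexify_hermsymmx.
Qed.

Lemma complexify_char_poly : char_poly A = \prod_i ('X - (sp 0 i)%:P).
Proof.
rewrite complexify_spectralE char_poly_conjmx ?spectral_unit //.
rewrite char_poly_trig ?diag_mx_is_trig //.
by apply: eq_bigr => i _; rewrite mxE eqxx mulr1n.
Qed.

(** Two distinct indices would give two positive roots whose linear factors divide the
    characteristic polynomial, over the complex numbers and hence over the reals. *)
Lemma antiferromagnetic_spectrum i j : antiferromagnetic G ->
  0 < sp 0 i -> 0 < sp 0 j -> i = j.
Proof.
move=> afG; have [//|neq_ij] := eqVneq i j.
rewrite !ltcE /= => /andP[/eqP Imi Rei] /andP[/eqP Imj Rej].
have spE k : complex.Im (sp 0 k) = 0 -> sp 0 k = toC (complex.Re (sp 0 k)).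
  by case: (sp 0 k) => x y /= ->.
have := afG [:: complex.Re (sp 0 i); complex.Re (sp 0 j)].
rewrite /= Rei Rej /= => /(_ isT); rewrite big_cons big_seq1 => absurd.
suff /absurd : ('X - (complex.Re (sp 0 i))%:P) * ('X - (complex.Re (sp 0 j))%:P)
    %| char_poly G by [].
rewrite -(dvdp_map toC) map_char_poly complexify_char_poly rmorphM /=.
rewrite !map_polyXsubC /= -(spE i Imi) -(spE j Imj) // (bigD1 i) //=.
rewrite (bigD1 j) 1?eq_sym //=.
by rewrite mulrA dvdp_mulr.
Qed.

Lemma antiferromagnetic_hyperbolic : antiferromagnetic G -> hyperbolic G.
Proof.
move=> afG v w w_ge0.
pose toV (x : 'rV[R]_m) := map_mx toC x.
pose e (x : 'rV[C]_m) := x *m P^t*.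
have toV_conj x : (toV x)^t* = (toV x)^T.
  by apply/matrixP=> s t; rewrite !mxE; apply/CrealP; rewrite complex_real.
have qE x y : (toV x *m A *m (toV y)^T) 0 0 = toC (bform G x y).
  by rewrite /toV map_trmx -!map_mxM mxE.
have uE u : (u *m A *m u^t*) 0 0 = \sum_i sp 0 i * `|e u 0 i| ^+ 2.
  rewrite complexify_spectralE invmx_unitary ?spectral_unitarymx //.
  rewrite !mulmxA -(mulmxA _ P).
  have -> : P *m u^t* = (e u)^t*.
    by rewrite /e trmx_mul map_mxM /= trmxCK.
  rewrite mxE; apply: eq_bigr => i _.
  by rewrite mul_mx_diag !mxE normCK -!mulrA mulrCA.
have sp_real i : sp 0 i \is Num.real.
  exact/mxOverP/hermitian_spectral_diag_real/complexify_hermsymmx.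
have eB a x y i : e (x - a *: y) 0 i = e x 0 i - a * e y 0 i.
  rewrite /e mulmxBl -scalemxAl; move: (x *m _) (y *m _) => x' y'.
  by rewrite !mxE.
have nonpos u : (forall i, 0 < sp 0 i -> e u 0 i = 0) ->
    (u *m A *m u^t*) 0 0 <= 0.
  move=> eu0; rewrite uE; apply: sumr_le0 => i _.
  have [/eu0 ->|] := boolP (0 < sp 0 i); first by rewrite normr0 expr0n mulr0.
  rewrite -real_leNgt ?real0 // => sp_le0.
  by rewrite mulr_le0_ge0 // exprn_ge0.
(* Only one coordinate can be positive, and [c] makes it vanish at v - c w. If it already vanishes
   at [w], then <w, G w> is at most 0. The eigenbasis is complex, so [c] may be too. *)
have [->|[c eu0]] : bform G w w = 0 \/
    exists c, forall i, 0 < sp 0 i -> e (toV v - c *: toV w) 0 i = 0.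
  case: (pickP (fun i => 0 < sp 0 i)) => [i0 sp0|sp0]; last first.
    by right; exists 0 => i; rewrite sp0.
  have [w0|w_neq0] := eqVneq (e (toV w) 0 i0) 0; [left|right].
    apply/eqP; rewrite eq_le w_ge0 andbT.
    have := nonpos (toV w); rewrite toV_conj qE lecR; apply => i spi.
    by rewrite (antiferromagnetic_spectrum afG spi sp0).
  exists (e (toV v) 0 i0 / e (toV w) 0 i0) => i spi.
  by rewrite (antiferromagnetic_spectrum afG spi sp0) eB divfK ?subrr.
  by rewrite mulr0 sqr_ge0.
have := nonpos _ eu0; case: c eu0 => a b _.
have -> : (toV v - (Complex a b) *: toV w)^t* =
    (toV v)^T - (Complex a (- b)) *: (toV w)^T.
  by rewrite linearB linearZ /= map_mxB map_mxZ /= !toV_conj.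
rewrite mulmxBr !mulmxBl.
do !rewrite -?scalemxAl -?scalemxAr.
have subE (X Y : 'M[C]_1) : (X - Y) 0 0 = X 0 0 - Y 0 0 by rewrite !mxE.
have scaleE k (X : 'M[C]_1) : (k *: X) 0 0 = k * X 0 0 by rewrite !mxE.
rewrite !(subE, scaleE, qE) [bform G w v]bformC //.
rewrite lecE /= => /andP[_].
set q11 := bform G v v; set q12 := bform G v w; set q22 := bform G w w.
rewrite ?(mul0r, mulr0, subr0, oppr0, addr0) => le0.
(* The imaginary part of [c] only adds b^2 q22, which is nonnegative, so the real discriminant
   argument goes through. *)
have {le0} : q11 - 2 * a * q12 + (a ^+ 2 + b ^+ 2) * q22 <= 0.
  by apply: le_trans le0; rewrite le_eqVlt; apply/orP; left; apply/eqP; ring.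
move/(ler_wpM2l w_ge0); rewrite mulr0 -/q22.
have := sqr_ge0 (a * q22 - q12); have := sqr_ge0 (b * q22).
nra.
Qed.
End SpectralHyperbolic.

(** * Clique partition functions *)

Section CliquePolynomial.
Variables (R : realFieldType) (m : nat) (G : 'M[R]_m).
Implicit Types (c d : 'I_m -> R) (f g : 'rV[R]_m) (fs : seq 'rV[R]_m).

(* The polarization of f |-> hom_f(K_n, G) at fs = [:: f_1; ..; f_n]:
   the sum over x of prod_a c(x_a) f_a(x_a) prod_(a < b) G(x_a, x_b). *)
Fixpoint polarZ c fs : R :=
  if fs is f :: fs' then
    \sum_s c s * f 0 s * polarZ (fun t => c t * G s t) fs'
  else 1.

(** Up to a positive factor, the Hessian of the clique polynomial differentiated along [fs]: two
    vertices are pinned at [s] and [t]. *)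
Definition polarM c fs : 'M[R]_m := \matrix_(s, t)
  (c s * c t * G s t * polarZ (fun r => c r * G s r * G t r) fs).

Lemma polarZ_cons c f fs : polarZ c (f :: fs) =
  \sum_s c s * f 0 s * polarZ (fun t => c t * G s t) fs.
Proof. by []. Qed.

Lemma eq_polarZ c c' fs : c =1 c' -> polarZ c fs = polarZ c' fs.
Proof.
elim: fs c c' => //= f fs IH c c' cc'; apply: eq_bigr => s _.
by rewrite cc'; congr (_ * _); apply: IH => t; rewrite cc'.
Qed.

Lemma polarZ_bform c f g fs :
  polarZ c (f :: g :: fs) = bform (polarM c fs) f g.
Proof.
rewrite bformE /=; apply: eq_bigr => s _; rewrite mulr_sumr.
by apply: eq_bigr => t _; rewrite mxE; ring.
Qed.

Hypothesis symG : G^T = G.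
Hypothesis G_gt0 : forall s t, 0 < G s t.

Let GC s t : G s t = G t s. Proof. by rewrite -{1}symG mxE. Qed.

Lemma polarM_sym c fs : (polarM c fs)^T = polarM c fs.
Proof.
apply/matrixP => s t; rewrite !mxE [G t s]GC [c t * _]mulrC.
by congr (_ * _); apply: eq_polarZ => r; rewrite mulrAC.
Qed.

Lemma perm_polarZ c fs gs : perm_eq fs gs -> polarZ c fs = polarZ c gs.
Proof.
have move_front f gs1 gs2 c' :
    polarZ c' (gs1 ++ f :: gs2) = polarZ c' (f :: gs1 ++ gs2).
  elim: gs1 c' => // g gs1 IH c'.
  transitivity (polarZ c' (g :: f :: gs1 ++ gs2)).
    by rewrite /=; apply: eq_bigr => s _; rewrite IH.
  by rewrite !polarZ_bform bformC // polarM_sym.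
elim: fs gs c => [|f fs IH] gs c; first by move/perm_size/esym/size0nil=> ->.
move=> fsgs; have : f \in gs by rewrite -(perm_mem fsgs) mem_head.
move=> f_gs; case/splitPr: gs / f_gs fsgs => gs1 gs2 fsgs; rewrite move_front.
apply: eq_bigr => s _; congr (_ * _); apply: IH.
by move: fsgs; rewrite perm_sym perm_catC /= perm_cons perm_catC perm_sym.
Qed.

Lemma polarZ_ge0 c fs : (forall s, 0 < c s) ->
  {in fs, forall f : 'rV_m, forall s, 0 < f 0 s} -> 0 <= polarZ c fs.
Proof.
elim: fs c => [|f fs IH] c c_gt0 fs_gt0 /=; first exact: ler01.
apply: sumr_ge0 => s _; rewrite mulr_ge0 //.
  by rewrite ltW // mulr_gt0 // fs_gt0 // mem_head.
apply: IH => [t|g g_fs]; first exact: mulr_gt0.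
by apply: fs_gt0; rewrite in_cons g_fs orbT.
Qed.

Lemma polarZ_gt0 (s0 : 'I_m) c fs : (forall s, 0 < c s) ->
  {in fs, forall f : 'rV_m, forall s, 0 < f 0 s} -> 0 < polarZ c fs.
Proof.
elim: fs c => [|f fs IH] c c_gt0 fs_gt0 /=; first exact: ltr01.
have term_gt0 s : 0 < c s * f 0 s * polarZ (fun t => c t * G s t) fs.
  rewrite !mulr_gt0 //; first by rewrite fs_gt0 // mem_head.
  apply: IH => [t|g g_fs]; first exact: mulr_gt0.
  by apply: fs_gt0; rewrite in_cons g_fs orbT.
rewrite (bigD1 s0) //= ltr_wpDr // sumr_ge0 // => s _; exact: ltW.
Qed.

(** Induction on the number of directions. With none left, the matrix is a diagonal congruence of
    [G]. Otherwise it contracts a symmetric tensor with [h], and each slice [T r] is a positive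
    multiple of the same kind of matrix with weights c_s G_rs. *)
Lemma polarM_hyperbolic c fs : hyperbolic G -> (forall s, 0 < c s) ->
  {in fs, forall f : 'rV_m, forall s, 0 < f 0 s} -> hyperbolic (polarM c fs).
Proof.
move=> hypG; elim: fs c => [|h fs IH] c c_gt0 fs_gt0.
  have scaled u v : bform (polarM c [::]) u v =
      bform G (\row_s (c s * u 0 s)) (\row_s (c s * v 0 s)).
    rewrite !bformE; apply: eq_bigr => s _; apply: eq_bigr => t _.
    by rewrite !mxE /=; ring.
  by move=> u w; rewrite !scaled; apply: hypG.
have fs'_gt0 : {in fs, forall f : 'rV_m, forall s, 0 < f 0 s}.
  by move=> g g_fs; apply: fs_gt0; rewrite in_cons g_fs orbT.
pose T r := c r *: polarM (fun s => c s * G r s) fs.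
have TE r s t : T r s t = c r * c s * c t * G r s * G r t * G s t *
    polarZ (fun q => c q * G r q * G s q * G t q) fs.
  by rewrite !mxE; ring.
have -> : polarM c (h :: fs) = \sum_r h 0 r *: T r.
  apply/matrixP => s t; rewrite summxE mxE polarZ_cons mulr_sumr.
  apply: eq_bigr => r _.
  rewrite mxE TE [G s r]GC [G t r]GC.
  set z := polarZ _ fs; set z' := polarZ _ fs.
  by have -> : z = z' by [apply: eq_polarZ => q; ring]; ring.
apply: local_hyperbolic => [r s t|r s t|r s t|s|r].
- rewrite TE !mulr_gt0 //; apply: polarZ_gt0 => // q.
  by rewrite !mulr_gt0.
- rewrite !TE [G s r]GC; set z := polarZ _ fs; set z' := polarZ _ fs.
  by have -> : z = z' by [apply: eq_polarZ => q; ring]; ring.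
- rewrite !TE [G t s]GC; set z := polarZ _ fs; set z' := polarZ _ fs.
  by have -> : z = z' by [apply: eq_polarZ => q; ring]; ring.
- by rewrite fs_gt0 // mem_head.
have scaled u v : bform (T r) u v =
    c r * bform (polarM (fun s => c s * G r s) fs) u v.
  by rewrite /bform -scalemxAr -scalemxAl mxE.
move=> u w; rewrite !scaled pmulr_rge0 // => w_ge0.
rewrite exprMn mulrACA -expr2 ler_pM2l ?exprn_gt0 //.
by apply: IH => // s; rewrite mulr_gt0.
Qed.

Section LogConcavity.
Variables (c : 'I_m -> R) (f g : 'rV[R]_m).
Hypotheses (hypG : hyperbolic G) (c_gt0 : forall s, 0 < c s).
Hypotheses (f_gt0 : forall s, 0 < f 0 s) (g_gt0 : forall s, 0 < g 0 s).

Let X a b := polarZ c (nseq a f ++ nseq b g).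

Let nseqs_gt0 a b :
  {in nseq a f ++ nseq b g, forall h : 'rV_m, forall s, 0 < h 0 s}.
Proof.
by move=> h; rewrite mem_cat !mem_nseq => /orP[|] /andP[_ /eqP ->].
Qed.

(** The three numbers are the values of one hyperbolic [polarM] at (f, f), (g, g) and (f, g). *)
Lemma polarZ_logconcave a b : X a.+2 b * X a b.+2 <= X a.+1 b.+1 ^+ 2.
Proof.
have front k : X a (k + b) = polarZ c (nseq k g ++ nseq a f ++ nseq b g).
  by apply: perm_polarZ; rewrite nseqD perm_catCA.
have front1 : X a.+1 b.+1 = polarZ c (f :: g :: nseq a f ++ nseq b g).
  by apply: perm_polarZ; rewrite /= perm_cons -cat1s perm_catCA.
rewrite front1 -[b.+2]/(2 + b)%N front -[X a.+2 b]/(polarZ c (f :: f :: _)).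
rewrite !polarZ_bform; apply: polarM_hyperbolic => //.
  exact: nseqs_gt0.
by rewrite -polarZ_bform polarZ_ge0 // -[_ :: _]/(nseq 2 g ++ _);
  move=> h; rewrite mem_cat mem_nseq => /orP[/andP[_ /eqP ->] //|/nseqs_gt0].
Qed.

(** Along a fixed a + b, log-concavity makes successive quotients decrease, so each is at most the
    first one. The vertex [s0] makes all terms positive, which allows cancelling. *)
Lemma polarZ_ends (s0 : 'I_m) a b :
  X a b.+1 * X (a + b.+1) 0 <= X a.+1 b * X (a + b) 1.
Proof.
elim: b a => [|b IH] a; first by rewrite addn0 addn1 mulrC.
have X_gt0 i j : 0 < X i j by apply: polarZ_gt0.
have := IH a.+1; rewrite !addSn -!addnS => le1.
rewrite -(ler_pM2l (X_gt0 a.+1 b.+1)) mulrCA.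
apply: le_trans (ler_wpM2l (ltW (X_gt0 _ _)) le1) _.
rewrite addnS mulrA [_ * X a.+2 b]mulrC [X in _ <= X]mulrA -expr2.
by rewrite ler_wpM2r ?polarZ_logconcave ?ltW.
Qed.
End LogConcavity.

(** * Parallel and crossed pairs of cliques *)

Fixpoint cliqueZ n c : R :=
  if n is n'.+1 then \sum_s c s * cliqueZ n' (fun t => c t * G s t) else 1.

(* The partition function of two copies of K_n ([b = false]) or of
   K_n x K_2 ([b = true]), with vertex weights c on the first copy and d on
   the second. *)
Fixpoint twistedZ (b : bool) n c d : R :=
  if n is n'.+1 then \sum_s \sum_t c s * d t *
    twistedZ b n' (fun r => c r * G (if b then t else s) r)
                  (fun r => d r * G (if b then s else t) r)
  else 1.

Lemma twistedZ_false n c d : twistedZ false n c d = cliqueZ n c * cliqueZ n d.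
Proof.
elim: n c d => [|n IH] c d /=; first by rewrite mulr1.
rewrite mulr_suml; apply: eq_bigr => s _; rewrite mulr_sumr.
by apply: eq_bigr => t _; rewrite IH; ring.
Qed.

Lemma eq_cliqueZ n c c' : c =1 c' -> cliqueZ n c = cliqueZ n c'.
Proof.
elim: n c c' => //= n IH c c' cc'; apply: eq_bigr => s _.
by rewrite cc'; congr (_ * _); apply: IH => t; rewrite cc'.
Qed.

Lemma polarZ_nseq n c f :
  polarZ c (nseq n f) = cliqueZ n (fun s => c s * f 0 s).
Proof.
elim: n c => //= n IH c; apply: eq_bigr => s _; congr (_ * _).
by rewrite IH; apply: eq_cliqueZ => t; rewrite mulrAC.
Qed.

Lemma clique_swap n c d : hyperbolic G ->
  (forall s, 0 < c s) -> (forall s, 0 < d s) ->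
  twistedZ false n c d <= twistedZ true n c d.
Proof.
move=> hypG; elim: n c d => // n IH c d c_gt0 d_gt0.
(* Fix the first vertex of each copy and uncross the rest by induction. The sum then factors into
   the two mixed polarizations with one exchanged argument. *)
have le1 : \sum_s \sum_t c s * d t * twistedZ false n
    (fun r => c r * G t r) (fun r => d r * G s r) <= twistedZ true n.+1 c d.
  apply: ler_sum => s _; apply: ler_sum => t _.
  rewrite ler_pM2l ?mulr_gt0 //.
  by apply: IH => r; rewrite mulr_gt0.
apply: le_trans le1.
case: (pickP 'I_m) => [s0 _|m0]; last by rewrite /= !big_pred0.
(* The weights [c] and [d] become the directions [f] and [g], over a common base weight 1. *)
pose one (s : 'I_m) : R := 1.
pose f := \row_s c s; pose g := \row_s d s.
have f_gt0 s : 0 < f 0 s by rewrite mxE.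
have g_gt0 s : 0 < g 0 s by rewrite mxE.
have polar_nseq k e (h : 'rV[R]_m) w : (forall s, w s * h 0 s = e s) ->
    polarZ w (nseq k h) = cliqueZ k e.
  by move=> whe; rewrite polarZ_nseq; apply: eq_cliqueZ => s.
have polar_cons k (h h' : 'rV[R]_m) :
    polarZ one (h :: nseq k h') =
    \sum_s h 0 s * cliqueZ k (fun t => h' 0 t * G s t).
  rewrite polarZ_cons; apply: eq_bigr => s _; rewrite mul1r; congr (_ * _).
  by apply: polar_nseq => t; rewrite mul1r mulrC.
have := @polarZ_ends one f g hypG (fun _ => ltr01) f_gt0 g_gt0 s0 0 n.
rewrite !add0n cat0s cats0.
rewrite (polar_nseq _ d g) => [|s]; last by rewrite mxE mul1r.
rewrite (polar_nseq _ c f) => [|s]; last by rewrite mxE mul1r.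
rewrite (@perm_polarZ _ (_ ++ nseq 1 g) (g :: nseq n f)); last first.
  by rewrite perm_catC perm_refl.
rewrite !polar_cons twistedZ_false mulrC => /le_trans; apply.
rewrite le_eqVlt; apply/orP; left; apply/eqP.
rewrite mulr_suml; apply: eq_bigr => s _; rewrite mulr_sumr.
apply: eq_bigr => t _; rewrite twistedZ_false !mxE.
rewrite [cliqueZ n (fun r => g 0 r * _)]
  (_ : _ = cliqueZ n (fun r => d r * G s r)).
  rewrite [cliqueZ n (fun r => f 0 r * _)]
    (_ : _ = cliqueZ n (fun r => c r * G t r)).
    by ring.
  by apply: eq_cliqueZ => r; rewrite mxE.
by apply: eq_cliqueZ => r; rewrite mxE.
Qed.
End CliquePolynomial.

(** * Twisting the cliques one at a time *)

Section PairProducts.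
Variables (R : comNzRingType) (V : eqType).
Implicit Types (g h : V -> V -> R) (L : seq V).

(** Pairs are oriented by list order, so that the product splits along a concatenation, here a
    clique and its complement. *)
Fixpoint pairprod g L : R :=
  if L is v :: L' then (\prod_(u <- L') g v u) * pairprod g L' else 1.

Lemma eq_pairprod_uniq g g' L : uniq L ->
  {in L &, forall u v, u != v -> g u v = g' u v} ->
  pairprod g L = pairprod g' L.
Proof.
elim: L => //= v L IH /andP[vL uniqL] gg'; congr (_ * _); last first.
  by apply: IH => // x y xL yL; apply: gg'; rewrite in_cons ?xL ?yL orbT.
apply: eq_big_seq => u uL; apply: gg'; rewrite ?mem_head //.
  by rewrite in_cons uL orbT.
by apply: contraNneq vL => ->.
Qed.

Lemma eq_pairprod g g' L : g =2 g' -> pairprod g L = pairprod g' L.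
Proof.
move=> gg'; elim: L => //= v L ->; congr (_ * _).
by apply: eq_bigr => u _; rewrite gg'.
Qed.

Lemma pairprodM g g' L :
  pairprod (fun u v => g u v * g' u v) L = pairprod g L * pairprod g' L.
Proof.
elim: L => [|v L IH] /=; first by rewrite mulr1.
by rewrite IH big_split /=; ring.
Qed.

Lemma pairprod_cat g L L' : pairprod g (L ++ L') =
  pairprod g L * (\prod_(u <- L) \prod_(v <- L') g u v) * pairprod g L'.
Proof.
elim: L => [|v L IH] /=; first by rewrite big_nil !mul1r.
by rewrite IH big_cat big_cons /=; ring.
Qed.

Lemma prod_pairs h L : \prod_(u <- L) \prod_(v <- L) h u v =
  pairprod (fun u v => h u v * h v u) L * \prod_(u <- L) h u u.
Proof.
elim: L => [|w L IH] /=; first by rewrite !big_nil mulr1.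
rewrite !big_cons [X in _ * X](eq_bigr (fun u => h u w * \prod_(v <- L) h u v)).
  by rewrite !big_split /= IH; ring.
by move=> u _; rewrite big_cons.
Qed.

End PairProducts.

Section FinPairProducts.
Variables (R : comNzRingType) (V : finType).
Implicit Types (g h : V -> V -> R) (L : seq V).

(** Any way of sharing an edge weight between the two orientations gives the same product; this
    covers both the enumeration order and the order of the sheets. *)
Lemma prod_orientation h g : (forall u, h u u = 1) ->
  (forall u v, h u v * h v u = g u v) ->
  \prod_u \prod_v h u v = pairprod g (index_enum V).
Proof.
move=> h1 hg; rewrite prod_pairs [X in _ * X]big1 => [|u _ //].
by rewrite mulr1; apply: eq_pairprod.
Qed.

Definition ranked g (u v : V) : R :=
  if (enum_rank u < enum_rank v)%N then g u v else 1.

Lemma ranked_sym g : (forall u, g u u = 1) -> (forall u v, g u v = g v u) ->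
  forall u v, ranked g u v * ranked g v u = g u v.
Proof.
move=> g1 symg u v; rewrite /ranked.
case: ltngtP => [_|_|/val_inj/enum_rank_inj ->]; rewrite ?mulr1 ?mul1r //.
Qed.

Lemma perm_pairprod g L L' : (forall u, g u u = 1) ->
  (forall u v, g u v = g v u) -> perm_eq L L' -> pairprod g L = pairprod g L'.
Proof.
move=> g1 symg LL'.
have E M : pairprod g M = \prod_(u <- M) \prod_(v <- M) ranked g u v.
  rewrite prod_pairs [X in _ * X]big1 => [|u _]; last by rewrite /ranked ltnn.
  by rewrite mulr1; apply: eq_pairprod => u v; rewrite ranked_sym.
rewrite !E (perm_big _ LL'); apply: eq_bigr => u _; exact: perm_big.
Qed.

End FinPairProducts.

(** * Sums over states frozen outside a list *)

Section Fibers.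
Variables (R : nmodType) (V P : finType).
Implicit Types (L : seq V) (r x : {ffun V -> P}).

Definition agree L r x := [forall u, (u \notin L) ==> (x u == r u)].

Definition upd r v p : {ffun V -> P} := [ffun u => if u == v then p else r u].

Lemma agreeP L r x : reflect (forall u, u \notin L -> x u = r u) (agree L r x).
Proof.
apply: (iffP forallP) => xr u; last by apply/implyP => /xr/eqP.
by move=> uL; have := xr u; rewrite uL => /eqP.
Qed.

Lemma agree_nil r : agree [::] r =1 pred1 r.
Proof.
move=> x; apply/agreeP/eqP => [xr|-> //]; apply/ffunP => u; exact: xr.
Qed.

Lemma sum_agree_cons v L r (F : {ffun V -> P} -> R) : v \notin L ->
  \sum_(x | agree (v :: L) r x) F x =
  \sum_p \sum_(x | agree L (upd r v p) x) F x.
Proof.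
move=> vL; rewrite (partition_big (fun x => x v) predT) //=.
apply: eq_bigr => p _; apply: eq_bigl => x.
apply/andP/agreeP => [[/agreeP xr /eqP xv] u uL|xr].
  rewrite ffunE; case: eqP => [-> //|/eqP uv].
  by apply: xr; rewrite in_cons negb_or uv.
split; last by rewrite (xr v vL) ffunE eqxx.
apply/agreeP => u; rewrite in_cons negb_or => /andP[uv uL].
by rewrite (xr u uL) ffunE (negPf uv).
Qed.

End Fibers.

Section Twisting.
Variables (R : realFieldType) (m : nat) (G : 'M[R]_m).
Variables (V : finType) (I : finType) (t : V -> I) (F : rel I).
Hypotheses (symG : G^T = G) (G_gt0 : forall i j, 0 < G i j).
Hypothesis (hypG : hyperbolic G) (symF : forall i j, F i j = F j i).
Local Notation state := {ffun V -> 'I_m * 'I_m}.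
Implicit Types (x r : state) (u v : V) (b : I -> bool).

Let GC i j : G i j = G j i. Proof. by rewrite -{1}symG mxE. Qed.

(** A state holds both maps at once: the two components of [x u] are the images of [u] in the two
    copies. The flag [e] selects crossed edges. *)
Definition link (e : bool) x u v : R :=
  if e then G (x u).1 (x v).2 * G (x u).2 (x v).1
  else G (x u).1 (x v).1 * G (x u).2 (x v).2.

Definition twist_edge b x u v : R :=
  if u == v then 1 else
  if t u == t v then link (b (t u)) x u v
  else if F (t u) (t v) then link false x u v else 1.

Definition twist_weight b x := pairprod (twist_edge b x) (index_enum V).

Lemma link_sym (e : bool) x u v : link e x u v = link e x v u.
Proof. by rewrite /link; case: e; rewrite GC [G (x u).2 _]GC // mulrC. Qed.

Lemma twist_edge_sym b x u v : twist_edge b x u v = twist_edge b x v u.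
Proof.
rewrite /twist_edge eq_sym [t u == t v]eq_sym symF !(link_sym _ x u v).
by case: eqP => // _; case: eqP => // ->.
Qed.

Lemma sum_agree_link (e : bool) (L : seq V) (c d : 'I_m -> R) r : uniq L ->
  \sum_(x | agree L r x)
     (\prod_(u <- L) (c (x u).1 * d (x u).2)) * pairprod (link e x) L =
  twistedZ G e (size L) c d.
Proof.
elim: L c d r => [|v L IH] c d r /=.
  move=> _; rewrite (big_pred1 r) => [|x]; last exact: agree_nil.
  by rewrite big_nil mulr1.
case/andP=> vL uniqL; rewrite sum_agree_cons // pair_bigA /=.
apply: eq_bigr => -[p q] _ /=.
rewrite -(IH _ _ (upd r v (p, q)) uniqL) mulr_sumr.
apply: eq_bigr => x /agreeP/(_ v vL); rewrite ffunE eqxx => xv.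
rewrite big_cons xv /= -!mulrA; congr (_ * (_ * _)); rewrite !mulrA -big_split.
congr (_ * _); apply: eq_bigr => u _ /=; rewrite /link xv /=.
by case: e {IH}; ring.
Qed.

Lemma sum_agree_twist_weight b i r :
  let L := [seq v <- index_enum V | t v == i] in
  let L' := [seq v <- index_enum V | t v != i] in
  \sum_(x | agree L r x) twist_weight b x =
  pairprod (twist_edge b r) L' * twistedZ G (b i) (size L)
    (fun s => \prod_(v <- L') if F i (t v) then G s (r v).1 else 1)
    (fun s => \prod_(v <- L') if F i (t v) then G s (r v).2 else 1).
Proof.
move=> L L'.
have uniqL : uniq L by rewrite filter_uniq // index_enum_uniq.
have uniqL' : uniq L' by rewrite filter_uniq // index_enum_uniq.
have memL v : (v \in L) = (t v == i) by rewrite mem_filter mem_index_enum andbT.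
have memL' v : (v \in L') = (t v != i).
  by rewrite mem_filter mem_index_enum andbT.
rewrite -(sum_agree_link _ _ _ r uniqL) mulr_sumr.
apply: eq_bigr => x /agreeP xr.
have xr' v : v \in L' -> x v = r v by rewrite memL' => ti; rewrite xr ?memL.
rewrite /twist_weight (@perm_pairprod _ _ _ _ (L ++ L')); first last.
- by rewrite perm_sym perm_filterC.
- exact: twist_edge_sym.
- by move=> u; rewrite /twist_edge eqxx.
rewrite pairprod_cat mulrC mulrA.
have -> : pairprod (twist_edge b x) L' = pairprod (twist_edge b r) L'.
  apply: eq_pairprod_uniq => // u v uL vL _.
  by rewrite /twist_edge /link !xr'.
rewrite -!mulrA; congr (_ * _); rewrite mulrC; congr (_ * _).
  apply: eq_big_seq => u; rewrite memL => /eqP tu; rewrite -big_split.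
  apply: eq_big_seq => v vL'; rewrite /twist_edge /link (xr' v vL') tu /=.
  have tv := vL'; rewrite memL' eq_sym in tv; rewrite (negPf tv).
  case: eqP => [uv|_]; first by rewrite -uv tu eqxx in tv.
  by case: (F _ _); rewrite ?mulr1.
apply: eq_pairprod_uniq => // u v; rewrite !memL => /eqP tu /eqP tv uv.
by rewrite /twist_edge (negPf uv) tu tv eqxx.
Qed.

Lemma sum_twist_weight_step b b' i : b i = false -> b' i = true ->
  (forall j, j != i -> b j = b' j) ->
  \sum_x twist_weight b x <= \sum_x twist_weight b' x.
Proof.
move=> bi b'i bb'.
(* [key] erases the state on clique [i]; its fibres are the states with a given outside, and
   [clique_swap] applies on each. *)
pose key x : {ffun V -> option ('I_m * 'I_m)} :=
  [ffun u => if t u == i then None else Some (x u)].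
rewrite (partition_big key predT) // [leRHS](partition_big key predT) //=.
apply: ler_sum => z _.
case: (pickP (fun x => key x == z)) => [r /eqP <-|none]; last first.
  by rewrite !big_pred0.
have keyE x : (key x == key r) =
    agree [seq v <- index_enum V | t v == i] r x.
  apply/eqP/agreeP => [kxr u|xr].
    rewrite mem_filter mem_index_enum andbT => /negPf tu.
    by have := congr1 (fun f : {ffun _} => f u) kxr; rewrite !ffunE tu => -[].
  apply/ffunP => u; rewrite !ffunE; case: ifP => // tu.
  by rewrite xr // mem_filter tu.
rewrite !(eq_bigl _ _ keyE) !sum_agree_twist_weight bi b'i.
set L' := [seq v <- _ | _ != i].
have -> : pairprod (twist_edge b r) L' = pairprod (twist_edge b' r) L'.
  apply: eq_pairprod_uniq; first by rewrite filter_uniq // index_enum_uniq.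
  move=> u v; rewrite !mem_filter => /andP[tu _] _ _.
  by rewrite /twist_edge bb'.
have c_gt0 (a : V -> 'I_m) s :
    0 < \prod_(v <- L') if F i (t v) then G s (a v) else 1.
  by apply: prodr_gt0 => v _; case: ifP.
apply: ler_wpM2l; last by apply: clique_swap => //; apply: c_gt0.
elim: (L') => //= v L1 IH; rewrite mulr_ge0 // prodr_ge0 // => u _.
rewrite /twist_edge /link; do !case: ifP => // _;
  by rewrite mulr_ge0 // ltW.
Qed.

Lemma sum_twist_weight_le :
  \sum_x twist_weight (fun=> false) x <= \sum_x twist_weight (fun=> true) x.
Proof.
have eqw b b' : b =1 b' ->
    \sum_x twist_weight b x = \sum_x twist_weight b' x.
  move=> bb'; apply: eq_bigr => x _; apply: eq_pairprod => u v.
  by rewrite /twist_edge bb'.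
(* The crossed cliques are those in a list, which grows from empty to all of [I]. *)
rewrite -(eqw (fun i => i \in enum I) (fun=> true)) => [|i]; last first.
  by rewrite mem_enum.
elim: (enum I) => [|i s IH].
  by rewrite (eqw _ (fun=> false)).
apply: (le_trans IH).
have [is_|nis] := boolP (i \in s).
  rewrite (eqw _ (fun j => j \in i :: s)) // => j; rewrite in_cons.
  by case: eqP => // ->.
apply: (@sum_twist_weight_step _ _ i); rewrite ?mem_head //.
  exact: negPf.
by move=> j ji; rewrite in_cons (negPf ji).
Qed.

End Twisting.

(** * Homomorphism numbers as products over pairs *)

Section HomWeights.
Variables (R : realType) (m : nat) (G : 'M[R]_m).
Hypothesis symG : G^T = G.

Let GC i j : G i j = G j i. Proof. by rewrite -{1}symG mxE. Qed.

Definition edge_weight (V : finType) (E : rel V) (phi : V -> 'I_m) u v : R :=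
  if E u v then G (phi u) (phi v) else 1.

Lemma edge_weight_sym (V : finType) (E : rel V) phi u v : simple_graph E ->
  edge_weight E phi u v = edge_weight E phi v u.
Proof. by case=> symE _; rewrite /edge_weight symE GC. Qed.

Lemma edge_weight_diag (V : finType) (E : rel V) phi u : simple_graph E ->
  edge_weight E phi u u = 1.
Proof. by case=> _ irrE; rewrite /edge_weight (negPf (irrE u)). Qed.

Lemma homG_pairprod (V : finType) (E : rel V) : simple_graph E ->
  homG E G = \sum_(phi : {ffun V -> 'I_m})
    pairprod (edge_weight E phi) (index_enum V).
Proof.
move=> sE; apply: eq_bigr => phi _.
rewrite -(@prod_orientation _ _ (ranked (edge_weight E phi))).
- apply: eq_bigr => u _; rewrite big_mkcond; apply: eq_bigr => v _.
  by rewrite /ranked /edge_weight; case: (E u v); case: ltnP.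
- by move=> u; rewrite /ranked ltnn.
apply: ranked_sym => u *; first exact: edge_weight_diag.
exact: edge_weight_sym.
Qed.

Lemma tensorK2_simple (V : finType) (E : rel V) :
  simple_graph E -> simple_graph (tensorK2 E).
Proof.
case=> symE irrE; split=> [x y|x]; last by rewrite /tensorK2 eqxx andbF.
by rewrite /tensorK2 symE eq_sym.
Qed.

Lemma homG_tensorK2 (V : finType) (E : rel V) : simple_graph E ->
  homG (tensorK2 E) G = \sum_(phi : {ffun V * bool -> 'I_m})
    pairprod (fun u v => if E u v then G (phi (u, false)) (phi (v, true)) *
                                       G (phi (v, false)) (phi (u, true)) else 1)
             (index_enum V).
Proof.
move=> sE; have sE2 := tensorK2_simple sE.
rewrite homG_pairprod //; apply: eq_bigr => phi _.
(* Every edge of the double cover joins the two sheets, so it can be oriented from [false] to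
   [true]. *)
pose h (x y : V * bool) : R :=
  if ~~ x.2 && y.2 then edge_weight (tensorK2 E) phi x y else 1.
rewrite -(@prod_orientation _ _ h); first last.
- move=> x y; rewrite /h [edge_weight _ _ y x]edge_weight_sym //.
  case: x y => [u []] [v []] /=; rewrite ?mulr1 ?mul1r //.
    by rewrite /edge_weight /tensorK2 andbF.
  by rewrite /edge_weight /tensorK2 andbF.
- by move=> x; rewrite /h andNb.
pose h' u v := edge_weight (tensorK2 E) phi (u, false) (v, true).
rewrite -(@prod_orientation _ _ h'); first last.
- move=> u v; rewrite /h' /edge_weight /tensorK2 /= !andbT.
  by rewrite [E v u](proj1 sE); case: (E u v); rewrite ?mulr1.
- by move=> u; rewrite /h' /edge_weight /tensorK2 /= (negPf (proj2 sE u)).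
transitivity (\prod_u \prod_(b : bool) \prod_(y : V * bool) h (u, b) y).
  by rewrite [RHS]pair_bigA; apply: eq_bigr => -[].
apply: eq_bigr => u _; rewrite big_bool /= [X in X * _]big1 => [|y _ //].
rewrite mul1r; transitivity (\prod_v \prod_(b : bool) h (u, false) (v, b)).
  by rewrite [RHS]pair_bigA; apply: eq_bigr => -[].
by apply: eq_bigr => v _; rewrite big_bool /= /h /= mulr1.
Qed.

End HomWeights.

(** * Clique blow-ups as twisted sums *)

Section Blowup.
Variables (R : realType) (m : nat) (G : 'M[R]_m).
Variables (k : nat) (F : rel 'I_k) (n : 'I_k -> nat).
Hypotheses (symG : G^T = G) (sF : simple_graph F).
Local Notation V := (blowup_vertex n).

Let GC i j : G i j = G j i. Proof. by rewrite -{1}symG mxE. Qed.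

Lemma blowup_simple : simple_graph (blowup F n).
Proof.
case: sF => symF _; split=> [u v|u]; last by rewrite /blowup eqxx.
by rewrite /blowup eq_sym [tag u == _]eq_sym symF.
Qed.

Local Notation weight := (twist_weight G (fun v : V => tag v) F).

Lemma homG_blowup_sqr :
  homG (blowup F n) G ^+ 2 = \sum_x weight (fun=> false) x.
Proof.
rewrite homG_pairprod //; last exact: blowup_simple.
rewrite expr2 mulr_suml.
under eq_bigr do rewrite mulr_sumr.
pose T := {ffun V -> 'I_m}.
rewrite pair_bigA (reindex (fun x : {ffun V -> 'I_m * 'I_m} =>
  ([ffun v => (x v).1] : T, [ffun v => (x v).2] : T))) /=; last first.
  exists (fun p : T * T => [ffun v => (p.1 v, p.2 v)]) => [x _|[f g] _].
    by apply/ffunP => v; rewrite !ffunE; case: (x v).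
  by congr (_, _); apply/ffunP => v; rewrite !ffunE.
apply: eq_bigr => x _; rewrite -pairprodM; apply: eq_pairprod => u v.
rewrite /edge_weight /twist_edge /blowup !ffunE /link.
case: eqP => //= _; rewrite ?mulr1 //.
by case: eqP => //= _; case: (F _ _); rewrite ?mulr1.
Qed.

(* Swapping the two sheets of the double cover over one colour class of F
   makes the edges between distinct cliques parallel. *)
Lemma homG_blowup_tensorK2 : bipartite F ->
  homG (tensorK2 (blowup F n)) G = \sum_x weight (fun=> true) x.
Proof.
case=> col colF; rewrite homG_tensorK2 //; last exact: blowup_simple.
pose T := {ffun V * bool -> 'I_m}.
rewrite (reindex (fun x : {ffun V -> 'I_m * 'I_m} =>
  [ffun y => if y.2 == col (tag y.1) then (x y.1).1 else (x y.1).2] : T))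
  /=; last first.
  exists (fun f : T => [ffun v => (f (v, col (tag v)), f (v, ~~ col (tag v)))])
    => [x _|f _].
    apply/ffunP => v; rewrite !ffunE /= eqxx; case: (x v) => p q.
    by case: (col _).
  by apply/ffunP => -[v b]; rewrite !ffunE /=; case: b; case: (col _).
apply: eq_bigr => x _; apply: eq_pairprod => u v.
rewrite /twist_edge /blowup !ffunE /link /=.
case: eqP => //= _; case: eqP => [<-|_] /=.
  by case: (col _) => /=; rewrite ?[G (x u).2 _]GC ?[G (x v).2 _]GC // mulrC.
have := colF (tag u) (tag v); case: (F _ _) => // /(_ isT).
case: (col (tag u)); case: (col (tag v)) => //= _.
  by rewrite [G (x v).1 _]GC mulrC.
by rewrite [G (x v).2 _]GC.
Qed.

Lemma homG_blowup_le : (forall i j, 0 < G i j) -> hyperbolic G ->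
  bipartite F ->
  homG (blowup F n) G ^+ 2 <= homG (tensorK2 (blowup F n)) G.
Proof.
move=> G_gt0 hypG bipF; rewrite homG_blowup_sqr homG_blowup_tensorK2 //.
by apply: sum_twist_weight_le => //; case: sF.
Qed.

End Blowup.

(** * Perturbation to positive weights *)

Section LipschitzAtZero.
Variable R : realFieldType.
Implicit Types (f g : R -> R).

(** A quantitative right continuity at 0, stable under sums and products and hence inherited by
    [homG], a polynomial in the entries. *)
Definition lipschitz0 f :=
  exists C : R, forall x : R, 0 <= x <= 1 -> `|f x - f 0| <= C * x.

Lemma lipschitz0_const a : lipschitz0 (fun=> a).
Proof. by exists 0 => x _; rewrite subrr normr0 mul0r. Qed.

Lemma lipschitz0_id : lipschitz0 id.
Proof. by exists 1 => x /andP[x0 _]; rewrite subr0 ger0_norm // mul1r. Qed.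

Lemma lipschitz0D f g :
  lipschitz0 f -> lipschitz0 g -> lipschitz0 (fun x => f x + g x).
Proof.
move=> [C fC] [D gD]; exists (C + D) => x x01.
rewrite mulrDl opprD addrACA (le_trans (ler_normD _ _)) //.
by rewrite lerD ?fC ?gD.
Qed.

Lemma lipschitz0M f g :
  lipschitz0 f -> lipschitz0 g -> lipschitz0 (fun x => f x * g x).
Proof.
(* On [0, 1], |f x| is at most |f 0| + C. *)
move=> [C fC] [D gD]; exists ((`|f 0| + C) * D + `|g 0| * C) => x x01.
have -> : f x * g x - f 0 * g 0 = f x * (g x - g 0) + g 0 * (f x - f 0).
  by ring.
rewrite (le_trans (ler_normD _ _)) // !normrM mulrDl -!mulrA.
have fx := fC x x01; have gx := gD x x01; case/andP: x01 => x0 x1.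
rewrite lerD ?ler_wpM2l // ler_pM // -lerBlDl.
have C_ge0 : 0 <= C.
  have := fC 1; rewrite ler01 lexx mulr1 => /(_ isT); exact: le_trans.
rewrite (le_trans (lerB_dist _ _)) // (le_trans fx) //.
by rewrite ler_piMr.
Qed.

Lemma lipschitz0_sum (I : Type) (r : seq I) (P : pred I) (f : I -> R -> R) :
  (forall i, lipschitz0 (f i)) ->
  lipschitz0 (fun x => \sum_(i <- r | P i) f i x).
Proof.
move=> lf; elim: r => [|i r [C IH]].
  by exists 0 => x _; rewrite !big_nil subrr normr0 mul0r.
have [D fD] : lipschitz0
    (fun x => (if P i then f i x else 0) + \sum_(j <- r | P j) f j x).
  apply: lipschitz0D; last by exists C.
  by case: (P i) => //; apply: lipschitz0_const.
exists D => x /fD; rewrite !big_cons.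
by case: (P i); rewrite ?add0r.
Qed.

Lemma lipschitz0_prod (I : Type) (r : seq I) (P : pred I) (f : I -> R -> R) :
  (forall i, lipschitz0 (f i)) ->
  lipschitz0 (fun x => \prod_(i <- r | P i) f i x).
Proof.
move=> lf; elim: r => [|i r [C IH]].
  by exists 0 => x _; rewrite !big_nil subrr normr0 mul0r.
have [D fD] : lipschitz0
    (fun x => (if P i then f i x else 1) * \prod_(j <- r | P j) f j x).
  apply: lipschitz0M; last by exists C.
  by case: (P i) => //; apply: lipschitz0_const.
exists D => x /fD; rewrite !big_cons.
by case: (P i); rewrite ?mul1r.
Qed.

Lemma lipschitz0_le f g : lipschitz0 f -> lipschitz0 g ->
  (forall x, 0 < x -> f x <= g x) -> f 0 <= g 0.
Proof.
move=> [C fC] [D gD] fg; rewrite leNgt; apply/negP => gf.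
pose e := f 0 - g 0; have e_gt0 : 0 < e by rewrite subr_gt0.
have CD0 : 0 <= C + D.
  have h1 : 0 <= (1 : R) <= 1 by rewrite ler01 lexx.
  have := le_trans (normr_ge0 _) (fC 1 h1).
  by have := le_trans (normr_ge0 _) (gD 1 h1); rewrite !mulr1 => *; lra.
(* This point lies in (0, 1] and satisfies (C + D) x < e, so [f x] and [g x] cannot close the gap
   [e]. *)
pose x := e / (C + D + e + 1).
have d_gt0 : 0 < C + D + e + 1 by lra.
have xE : x * (C + D + e + 1) = e by rewrite divfK ?gt_eqF.
have x_gt0 : 0 < x by rewrite divr_gt0.
have x01 : 0 <= x <= 1.
  by rewrite ltW //= ler_pdivrMr // mul1r; lra.
have := fC x x01; have := gD x x01; have := fg x x_gt0.
rewrite !ler_norml => fgx /andP[_ gx] /andP[fx _].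
have : (C + D) * x < e by rewrite -xE; nra.
by rewrite /e; nra.
Qed.

End LipschitzAtZero.

Lemma lipschitz0_homG (R : realType) (m : nat) (H : R -> 'M[R]_m)
    (V : finType) (E : rel V) :
  (forall i j, lipschitz0 (fun x => H x i j)) ->
  lipschitz0 (fun x => homG E (H x)).
Proof.
move=> lH; apply: lipschitz0_sum => phi; apply: lipschitz0_prod => u.
by apply: lipschitz0_prod => v.
Qed.

Lemma hyperbolic_const_mx (R : realFieldType) (m : nat) (a : R) :
  hyperbolic (const_mx a : 'M_m).
Proof.
have E u v : bform (const_mx a : 'M_m) u v =
    a * (\sum_i u 0 i) * (\sum_i v 0 i).
  rewrite bformE -mulrA mulr_suml mulr_sumr; apply: eq_bigr => s _.
  by rewrite mulrA mulr_sumr; apply: eq_bigr => t _; rewrite mxE; ring.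
by move=> u w _; rewrite !E le_eqVlt; apply/orP; left; apply/eqP; ring.
Qed.

Lemma hyperbolic_congr (R : realFieldType) (m : nat) (G S : 'M[R]_m) :
  hyperbolic G -> hyperbolic (S *m G *m S^T).
Proof.
have E u v : bform (S *m G *m S^T) u v = bform G (u *m S) (v *m S).
  by rewrite /bform trmx_mul !mulmxA.
by move=> hypG u w; rewrite !E; apply: hypG.
Qed.

Lemma positive_perturbation (R : realFieldType) (m : nat) (G : 'M[R]_m) :
  G^T = G -> (forall i j, 0 <= G i j) -> hyperbolic G ->
  exists H : R -> 'M[R]_m,
    [/\ H 0 = G, forall i j, lipschitz0 (fun x => H x i j) &
        forall x, 0 < x -> [/\ (H x)^T = H x, forall i j, 0 < H x i j &
                              hyperbolic (H x)]].
Proof.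
move=> symG G_ge0 hypG.
have [G0|/matrix0Pn[a [b Gab]]] := eqVneq G 0.
  (* A congruence leaves the zero matrix zero, so here the rank-one matrix x J is used instead. *)
  exists (fun x => const_mx x); split=> [|i j|x x_gt0].
  - by rewrite G0; apply/matrixP => i j; rewrite !mxE.
  - have [C lC] := lipschitz0_id R.
    by exists C => x /lC; rewrite !mxE.
  split=> [|i j|]; first by rewrite trmx_const.
    by rewrite mxE.
  exact: hyperbolic_const_mx.
(* For x > 0 all entries of [S x] are positive, so the single positive entry G_ab makes every entry
   of S G S positive; congruence preserves hyperbolicity. *)
pose S (x : R) : 'M[R]_m := 1%:M + const_mx x.
have symS x : (S x)^T = S x by rewrite linearD /= trmx1 trmx_const.
have SE x i j : S x i j = (i == j)%:R + x by rewrite !mxE.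
exists (fun x => S x *m G *m (S x)^T); split=> [|i j|x x_gt0].
- rewrite symS; suff -> : S 0 = 1%:M by rewrite mulmx1 mul1mx.
  by apply/matrixP => i j; rewrite SE mxE addr0.
- have [C lC] : lipschitz0 (fun x => \sum_t (\sum_s S x i s * G s t) * S x t j).
    have lS s t : lipschitz0 (fun x => S x s t).
      have [C lC] :=
        lipschitz0D (lipschitz0_const (s == t)%:R) (lipschitz0_id R).
      by exists C => x /lC; rewrite !SE.
    apply: lipschitz0_sum => t; apply: lipschitz0M => //.
    apply: lipschitz0_sum => s; apply: lipschitz0M => //.
    exact: lipschitz0_const.
  have E x : (S x *m G *m (S x)^T) i j =
      \sum_t (\sum_s S x i s * G s t) * S x t j.
    by rewrite symS mxE; apply: eq_bigr => t _; rewrite mxE.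
  by exists C => x /lC; rewrite !E.
split; last exact: hyperbolic_congr.
  by rewrite !trmx_mul trmxK symG mulmxA.
move=> i j; have S_gt0 s t : 0 < S x s t by rewrite SE ltr_wpDl.
rewrite symS mxE (bigD1 b) //= ltr_wpDr //.
  apply: sumr_ge0 => t _; rewrite (mulr_ge0 _ (ltW (S_gt0 t j))) // mxE.
  by apply: sumr_ge0 => s _; rewrite mulr_ge0 // ltW.
rewrite mulr_gt0 // mxE (bigD1 a) //= ltr_wpDr //.
  by apply: sumr_ge0 => s _; rewrite mulr_ge0 // ltW.
by rewrite mulr_gt0 // lt_def Gab G_ge0.
Qed.

Theorem theorem1p6 (R : realType) (m : nat) (G : 'M[R]_m)
    (k : nat) (F : rel 'I_k) (n : 'I_k -> nat) :
  weighted_graph G -> antiferromagnetic G ->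
  simple_graph F -> bipartite F -> (forall i, (0 < n i)%N) ->
  homG (blowup F n) G ^+ 2 <= homG (tensorK2 (blowup F n)) G.
Proof.
move=> [symG G_ge0] afG sF bipF _.
(* With [G] written as [H 0], the inequality for [H x] with x > 0 passes to the limit at 0. *)
have [H [<- lH H_gt0]] :=
  positive_perturbation symG G_ge0 (antiferromagnetic_hyperbolic symG afG).
apply: (@lipschitz0_le _ (fun x => homG (blowup F n) (H x) ^+ 2)
  (fun x => homG (tensorK2 (blowup F n)) (H x))).
- by apply: lipschitz0M; apply: lipschitz0_homG.
- exact: lipschitz0_homG.
by move=> x /H_gt0[symH posH hypH]; apply: homG_blowup_le.
Qed.
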